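(* Let $n\ge 2$ and let $(M,\mathfrak g,f)$ be an $n$-Lie algebra in the Loday–Pirashvili category $\mathcal{LM}$, where $\rho:\wedge^{n-1}\mathfrak g\to\mathfrak{gl}(M)$ denotes the representation of $\mathfrak g$ on $M$. Then the $n$-linear bracket on $M$ defined by $$[m_1,\dots,m_n]:=\rho(f(m_1),\dots,f(m_{n-1}))(m_n),\qquad m_1,\dots,m_n\in M,$$ makes $M$ a Leibniz $n$-algebra.
   Context: All vector spaces are over a fixed field; a linear map out of $\wedge^k$ is the same as an alternating $k$-linear map. A Leibniz $n$-algebra is a vector space $\mathfrak h$ with an $n$-linear bracket satisfying the fundamental identity $$[x_1,\dots,x_{n-1},[y_1,\dots,y_n]]=\sum_{i=1}^n[y_1,\dots,[x_1,\dots,x_{n-1},y_i],\dots,y_n]$$ for all $x_j,y_j\in\mathfrak h$. An $n$-Lie algebra is a Leibniz $n$-algebra whose bracket is totally skew-symmetric, i.e. a linear map $\wedge^n\mathfrak g\to\mathfrak g$. A representation of an $n$-Lie algebra $\mathfrak g$ on a vector space $V$ is a linear map $\rho:\wedge^{n-1}\mathfrak g\to\mathfrak{gl}(V)$ such that for all $x_j,y_j\in\mathfrak g$: (R1) $\rho(x_1,\dots,x_{n-1})\rho(y_1,\dots,y_{n-1})-\rho(y_1,\dots,y_{n-1})\rho(x_1,\dots,x_{n-1})=\sum_{i=1}^{n-1}\rho(y_1,\dots,[x_1,\dots,x_{n-1},y_i],\dots,y_{n-1})$; (R2) $\rho(x_1,\dots,x_{n-2},[y_1,\dots,y_n])=\sum_{i=1}^n(-1)^{n-i}\rho(y_1,\dots,\widehat{y_i},\dots,y_n)\rho(x_1,\dots,x_{n-2},y_i)$.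 An $n$-Lie algebra in $\mathcal{LM}$, denoted $(M,\mathfrak g,f)$, consists of an $n$-Lie algebra $\mathfrak g$, a representation $(M,\rho)$ of $\mathfrak g$, and a linear map $f:M\to\mathfrak g$ such that $f(\rho(x_1,\dots,x_{n-1})(m))=[x_1,\dots,x_{n-1},f(m)]$ for all $x_j\in\mathfrak g$, $m\in M$. *)

(* Defs.v *)
From mathcomp Require Import all_boot all_order all_algebra.

Set Implicit Arguments.
Unset Strict Implicit.
Unset Printing Implicit Defensive.

Import GRing.Theory.
Local Open Scope ring_scope.

(* Families v_1, ..., v_k are finite functions indexed from 0 by 'I_k.         *)
(* Vector spaces are lmodTypes over a field: no finite-dimensionality.         *)

(* (x_1, ..., x_(n-1), y); for n = 0 it is the empty family *)
Definition append (T : Type) (n : nat) (x : {ffun 'I_n.-1 -> T}) (y : T) :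
  {ffun 'I_n -> T} := [ffun i : 'I_n => oapp x y (insub (val i))].

(* (y_1, ..., z, ..., y_n), with z in position i *)
Definition subst_at (T : Type) (n : nat) (y : {ffun 'I_n -> T}) (i : 'I_n)
  (z : T) : {ffun 'I_n -> T} := [ffun j => if j == i then z else y j].

(* (y_1, ..., ^y_i, ..., y_n), with y_i omitted *)
Definition omit (T : Type) (n : nat) (y : {ffun 'I_n -> T}) (i : 'I_n) :
  {ffun 'I_n.-1 -> T} := [ffun j => y (lift i j)].

Definition init (T : Type) (n : nat) (y : {ffun 'I_n -> T}) :
  {ffun 'I_n.-1 -> T} := [ffun j => y (widen_ord (leq_pred n) j)].

Definition last_index (n : nat) (hn : (2 <= n)%N) : 'I_n :=
  Ordinal (etrans (ltn_predL n) (ltnW hn)).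

Definition multilinear (F : fieldType) (V W : lmodType F) (k : nat)
  (phi : {ffun 'I_k -> V} -> W) : Prop :=
  forall (v : {ffun 'I_k -> V}) (i : 'I_k),
    linear (fun x : V => phi (subst_at v i x)).

Definition alternating (F : fieldType) (V W : lmodType F) (k : nat)
  (phi : {ffun 'I_k -> V} -> W) : Prop :=
  forall (v : {ffun 'I_k -> V}) (i j : 'I_k),
    i != j -> v i = v j -> phi v = 0.

Record leibniz_nalgebra (F : fieldType) (n : nat) (h : lmodType F)
  (br : {ffun 'I_n -> h} -> h) : Prop := LeibnizNAlgebra {
  leibniz_multilinear : multilinear br;
  leibniz_fundamental : forall (x : {ffun 'I_n.-1 -> h}) (y : {ffun 'I_n -> h}),
    br (append x (br y)) =
    \sum_(i < n) br (subst_at y i (br (append x (y i))))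
}.

Record nLie_algebra (F : fieldType) (n : nat) (g : lmodType F)
  (br : {ffun 'I_n -> g} -> g) : Prop := NLieAlgebra {
  nLie_leibniz : leibniz_nalgebra br;
  nLie_alternating : alternating br
}.

(* Linear maps out of the exterior power of g are alternating multilinear      *)
(* maps; the vector space structure and equality on gl(V) are pointwise.       *)
(* With 0-based i, the sign (-1)^(n-i) becomes (-1)^(n-(i+1)).                 *)
Record nLie_representation (F : fieldType) (n : nat) (g V : lmodType F)
  (br : {ffun 'I_n -> g} -> g)
  (rho : {ffun 'I_n.-1 -> g} -> {linear V -> V}) : Prop :=
  NLieRepresentation {
  rep_multilinear : forall m : V, multilinear (fun x => rho x m);
  rep_alternating : forall m : V, alternating (fun x => rho x m);
  rep_R1 : forall (x y : {ffun 'I_n.-1 -> g}) (m : V),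
    rho x (rho y m) - rho y (rho x m) =
    \sum_(i < n.-1) rho (subst_at y i (br (append x (y i)))) m;
  rep_R2 : forall (x : {ffun 'I_n.-2 -> g}) (y : {ffun 'I_n -> g}) (m : V),
    rho (append x (br y)) m =
    \sum_(i < n) (-1) ^+ (n - i.+1) *:
      rho (omit y i) (rho (append x (y i)) m)
}.

Record nLie_algebra_LM (F : fieldType) (n : nat) (M g : lmodType F)
  (br : {ffun 'I_n -> g} -> g)
  (rho : {ffun 'I_n.-1 -> g} -> {linear M -> M})
  (f : {linear M -> g}) : Prop := NLieAlgebraLM {
  LM_nLie : nLie_algebra br;
  LM_rep : nLie_representation br rho;
  LM_equivariant : forall (x : {ffun 'I_n.-1 -> g}) (m : M),
    f (rho x m) = br (append x (f m))
}.

Definition LM_bracket (F : fieldType) (n : nat) (hn : (2 <= n)%N)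
  (M g : lmodType F) (rho : {ffun 'I_n.-1 -> g} -> {linear M -> M})
  (f : {linear M -> g}) (m : {ffun 'I_n -> M}) : M :=
  rho [ffun j => f (init m j)] (m (last_index hn)).

(* Main.v *)
Require Import Defs.
From mathcomp Require Import all_boot all_order all_algebra.

(** Split the fundamental identity for [M] at the last slot. Applying (R1) to
    the families [f x_j] and [f y_j] evaluated at [y_n] produces the summand
    [i = n] as the term [rho (f y) (rho (f x) y_n)], while equivariance of [f]
    rewrites each [[f x_1, ..., f x_(n-1), f y_i]] as [f [x_1, ..., x_(n-1), y_i]],
    giving the other summands. *)

Set Implicit Arguments.
Unset Strict Implicit.
Unset Printing Implicit Defensive.

Import GRing.Theory.
Local Open Scope ring_scope.

Section Families.
Variables (T : Type) (k : nat).
Implicit Types (x : {ffun 'I_k -> T}) (y : {ffun 'I_k.+1 -> T}) (z : T).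

(** Replaces the bound proof in [init] by the one [big_ord_recr] produces; ordinals are equal once
    their values are. *)
Lemma init_widen y (j : 'I_k) : init y j = y (widen_ord (leqnSn k) j).
Proof. by rewrite ffunE; congr (y _); apply: val_inj. Qed.

Lemma init_append x z : init (append (n := k.+1) x z) = x.
Proof. by apply/ffunP => j; rewrite !ffunE /= valK. Qed.

Lemma append_last x z : append (n := k.+1) x z ord_max = z.
(* [ord_max] has value [k], out of range for ['I_k], so [oapp] falls back to its default [z]. *)
Proof. by rewrite ffunE insubF //= ltnn. Qed.

Lemma init_subst_last y z : init (subst_at y ord_max z) = init y.
Proof.
apply/ffunP => j; rewrite !init_widen ffunE ifN //.
by rewrite -val_eqE /= neq_ltn ltn_ord.
Qed.

Lemma init_subst_widen y (i : 'I_k) z :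
  init (subst_at y (widen_ord (leqnSn k) i) z) = subst_at (init y) i z.
Proof. by apply/ffunP => j; rewrite init_widen !ffunE -init_widen ffunE. Qed.

Lemma subst_widen_last y (i : 'I_k) z :
  subst_at y (widen_ord (leqnSn k) i) z ord_max = y ord_max.
Proof. by rewrite ffunE ifN // -val_eqE /= neq_ltn ltn_ord orbT. Qed.

Lemma subst_at_same y i z : subst_at y i z i = z.
Proof. by rewrite ffunE eqxx. Qed.

End Families.

Definition map_family (A B : Type) (k : nat) (f : A -> B)
  (v : {ffun 'I_k -> A}) : {ffun 'I_k -> B} := [ffun j => f (v j)].

Lemma map_subst_at (A B : Type) (k : nat) (f : A -> B) (v : {ffun 'I_k -> A})
  (i : 'I_k) (z : A) :
  map_family f (subst_at v i z) = subst_at (map_family f v) i (f z).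
Proof. by apply/ffunP => j; rewrite !ffunE; case: eqP. Qed.

(** Serves multilinearity, where the last slot, acted on by [rho], differs in kind from those fed to
    [rho] through [f]. *)
Lemma ord_lastP (k : nat) (P : 'I_k.+1 -> Prop) :
  P ord_max -> (forall i : 'I_k, P (widen_ord (leqnSn k) i)) ->
  forall i, P i.
Proof.
move=> Pmax Pwiden i; have [lt_ik|le_ki] := ltnP i k.
  by rewrite (_ : i = widen_ord (leqnSn k) (Ordinal lt_ik)) //; apply: val_inj.
rewrite (_ : i = ord_max) //; apply: val_inj => /=.
by apply/eqP; rewrite eqn_leq le_ki -ltnS ltn_ord.
Qed.

Lemma LM_bracketE (F : fieldType) (k : nat) (hn : (2 <= k.+1)%N)
  (M g : lmodType F) (rho : {ffun 'I_k -> g} -> {linear M -> M})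
  (f : {linear M -> g}) (m : {ffun 'I_k.+1 -> M}) :
  LM_bracket (n := k.+1) hn rho f m = rho (map_family f (init m)) (m ord_max).
Proof. by rewrite /LM_bracket (_ : last_index hn = ord_max) //; apply: val_inj. Qed.

Theorem theorem3p2 (F : fieldType) (n : nat) (hn : (2 <= n)%N)
  (M g : lmodType F) (br : {ffun 'I_n -> g} -> g)
  (rho : {ffun 'I_n.-1 -> g} -> {linear M -> M}) (f : {linear M -> g}) :
  nLie_algebra_LM br rho f -> leibniz_nalgebra (LM_bracket hn rho f).
Proof.
(* With [n] equal to [k.+1], [n.-1] computes to [k]. *)
case: n hn br rho => [//|k] hn br rho [_ rep equiv].
split=> [v|x y].
  apply: ord_lastP => [|i] a u w; rewrite !LM_bracketE.
    by rewrite !init_subst_last !subst_at_same linearP.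
  rewrite !init_subst_widen !subst_widen_last !map_subst_at linearP.
  exact: (rep_multilinear rep).
rewrite big_ord_recr /= !LM_bracketE !init_append !append_last.
rewrite init_subst_last subst_at_same.
have /eqP := rep_R1 rep (map_family f x) (map_family f (init y)) (y ord_max).
(* The subtracted term of (R1), moved across, is exactly the isolated last summand; the rest is
   compared termwise. *)
rewrite subr_eq => /eqP ->; congr (_ + _); apply: eq_bigr => i _.
rewrite !LM_bracketE init_subst_widen subst_widen_last map_subst_at.
by rewrite init_append append_last equiv [map_family f _ i]ffunE init_widen.
Qed.
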